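(* Let $\mathcal{G}=f^2\,ds^2$ be a metric on the unit square torus $\mathbb{R}^2/\mathbb{Z}^2$, where $ds^2=dx^2+dy^2$ and $f>0$ is the conformal factor. If $f$ only depends on one of the two variables $x,y$, then $$\operatorname{area}(\mathcal{G}) - \operatorname{Var}(f) \;\geq\; \Bigl(\operatorname{sys}(\mathcal{G}) + \tfrac12\,|f_0|_1\Bigr)^2,$$ where $f_0=f-m$ and $m$ is the expected value of $f$.
   Context: The systole $\operatorname{sys}(\mathcal{G})$ is the least $\mathcal{G}$-length of a noncontractible loop on the torus; $\operatorname{area}(\mathcal{G})$ is the total area. Expectation and variance are with respect to the measure $dx\,dy$ on $\mathbb{R}^2/\mathbb{Z}^2$ (a probability measure): $m=E(f)=\int f\,dx\,dy$, $\operatorname{Var}(f)=\int (f-m)^2\,dx\,dy$. $|\cdot|_1$ is the $L^1$-norm with respect to $dx\,dy$. *)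

(* Defs.v *)
From HB Require Import structures.
From mathcomp Require Import all_boot all_order all_algebra generic_quotient.
From mathcomp Require Import all_classical all_reals all_analysis.

Set Implicit Arguments.
Unset Strict Implicit.
Unset Printing Implicit Defensive.

Import Order.TTheory GRing.Theory Num.Theory.
Import numFieldNormedType.Exports.

Local Open Scope classical_set_scope.
Local Open Scope ring_scope.
Local Open Scope quotient_scope.

Section Torus.
Context {R : realType}.

Definition lattice_rel (p q : R * R) : bool :=
  (p.1 - q.1 \is a Num.int) && (p.2 - q.2 \is a Num.int).

Lemma lattice_rel_refl : reflexive lattice_rel.
Proof. by move=> p; rewrite /lattice_rel !subrr rpred0. Qed.

Lemma lattice_rel_sym : symmetric lattice_rel.
Proof.
move=> p q; rewrite /lattice_rel -(rpredN _ (p.1 - q.1)) opprB.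
by rewrite -(rpredN _ (p.2 - q.2)) opprB.
Qed.

Lemma lattice_rel_trans : transitive lattice_rel.
Proof.
move=> q p r /andP[pq1 pq2] /andP[qr1 qr2]; apply/andP; split.
  by rewrite -(subrKA q.1) rpredD.
by rewrite -(subrKA q.2) rpredD.
Qed.

Canonical lattice_equiv :=
  EquivRel lattice_rel lattice_rel_refl lattice_rel_sym lattice_rel_trans.

(* R^2/Z^2 *)
Definition torus : Type := quotient_topology {eq_quot lattice_equiv}.

HB.instance Definition _ :=
  Topological.copy torus (quotient_topology {eq_quot lattice_equiv}).

Definition torus_proj (x y : R) : torus := \pi_({eq_quot lattice_equiv}) (x, y).

(* Integral against dx dy, computed on the fundamental domain [0, 1]^2. *)
Definition torus_integral (h : torus -> R) : R :=
  \int[(lebesgue_measure \x lebesgue_measure)%E]_(p in `[0, 1] `*` `[0, 1])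
    h (torus_proj p.1 p.2).

Definition torus_mean (f : torus -> R) : R := torus_integral f.

Definition torus_variance (f : torus -> R) : R :=
  torus_integral (fun p => (f p - torus_mean f) ^+ 2).

Definition L1norm (f : torus -> R) : R := torus_integral (fun p => `|f p|).

Definition centered (f : torus -> R) : torus -> R := fun p => f p - torus_mean f.

Definition only_depends_on_x (f : torus -> R) : Prop :=
  forall x y y' : R, f (torus_proj x y) = f (torus_proj x y').

Definition only_depends_on_y (f : torus -> R) : Prop :=
  forall x x' y : R, f (torus_proj x y) = f (torus_proj x' y).

(* The tensor gxx dx^2 + 2 gxy dx dy + gyy dy^2. *)
Record metric_tensor := MetricTensor {
  gxx : torus -> R ; gxy : torus -> R ; gyy : torus -> R }.

Definition flat : metric_tensor :=
  MetricTensor (fun=> 1) (fun=> 0) (fun=> 1).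

(* f^2 g *)
Definition conformal (f : torus -> R) (g : metric_tensor) : metric_tensor :=
  MetricTensor (fun p => f p ^+ 2 * gxx g p) (fun p => f p ^+ 2 * gxy g p)
               (fun p => f p ^+ 2 * gyy g p).

Definition area (g : metric_tensor) : R :=
  torus_integral (fun p => Num.sqrt (gxx g p * gyy g p - gxy g p ^+ 2)).

Definition tangent_norm (g : metric_tensor) (p : torus) (u v : R) : R :=
  Num.sqrt (gxx g p * u ^+ 2 + 2 * gxy g p * (u * v) + gyy g p * v ^+ 2).

Definition C1 (x : R -> R) : Prop :=
  (forall t : R, derivable x t 1) /\ continuous (derive1 x).

(* [has_length g c a b l]: the curve c in the torus is piecewise C^1 on [a, b]
   and has g-length l.  On each piece c is given in the covering coordinates by
   a C^1 map; taking that map C^1 on all of R loses nothing, since a C^1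
   function on a compact interval extends to R.  *)
Inductive has_length (g : metric_tensor) (c : R -> torus) :
    R -> R -> R -> Prop :=
| length_piece (a b : R) (x y : R -> R) :
    a < b -> C1 x -> C1 y ->
    (forall t : R, a <= t <= b -> c t = torus_proj (x t) (y t)) ->
    has_length g c a b
      (\int[lebesgue_measure]_(t in `[a, b])
         tangent_norm g (c t) (derive1 x t) (derive1 y t))
| length_cat (a b d l1 l2 : R) :
    has_length g c a b l1 -> has_length g c b d l2 ->
    has_length g c a d (l1 + l2).

Definition loop (c : R -> torus) : Prop :=
  {within `[0, 1], continuous c} /\ c 0 = c 1.

(* Free homotopy (s, t) |-> H (s, t) through loops from c to a constant. *)
Definition contractible (c : R -> torus) : Prop :=
  exists H : R * R -> torus,
    [/\ {within `[0, 1] `*` `[0, 1], continuous H},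
        (forall t : R, 0 <= t <= 1 -> H (0, t) = c t),
        (forall s : R, 0 <= s <= 1 -> H (s, 0) = H (s, 1)) &
        exists p : torus, forall t : R, 0 <= t <= 1 -> H (1, t) = p].

Definition systole (g : metric_tensor) : R :=
  inf [set l | exists c : R -> torus,
    [/\ loop c, ~ contractible c & has_length g c 0 1 l]].

End Torus.

Arguments torus : clear implicits.
Arguments metric_tensor : clear implicits.

(* Main.v *)
Require Import Defs.
From mathcomp Require Import all_boot all_order all_algebra.
From mathcomp Require Import all_classical all_reals all_analysis.
From mathcomp Require Import generic_quotient measurable_realfun zify ring lra.
Import Order.TTheory GRing.Theory Num.Theory.
Import numFieldNormedType.Exports.
Local Open Scope classical_set_scope.
Local Open Scope ring_scope.

Set Implicit Arguments.
Unset Strict Implicit.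
Unset Printing Implicit Defensive.

(** Write [m] for the mean of [f].  Since [area - Var = m ^ 2], it suffices
    that [sys + |f_0|_1 / 2 <= m].  If [f] only depends on [x] and attains its
    minimum [a] at [x], the vertical loop through [x] has length [a], so
    [sys <= a]; and [|f - m| <= (f - m) + 2 (m - a)] pointwise gives
    [|f_0|_1 <= 2 (m - a)].

    That the vertical loop is not contractible is shown by a discretised
    winding number.  Sample a homotopy on an [N x N] grid fine enough that
    adjacent values differ, modulo integers, by less than 1/4 in the
    [y]-coordinate, and sum over each row the increments reduced to
    [[-1/2, 1/2)]: consecutive rows have the same sum by telescoping, but the
    sum is 1 on the vertical loop and 0 on a constant one. *)

(** * Reduction modulo integers and the discrete winding number *)

Lemma int_lt1_eq0 (R : realType) (x : R) :
  x \is a Num.int -> -1 < x -> x < 1 -> x = 0.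
Proof.
move=> /intrP[m ->].
rewrite -(mulrNz 1 1) (ltr_int _ (-1)) (ltr_int _ _ 1) => m1 m2.
by have -> : m = 0 by lia.
Qed.

Definition centered_frac (R : realType) (x : R) : R :=
  x - (Num.floor (x + 2^-1))%:~R.

Lemma centered_frac_mod (R : realType) (x : R) :
  x - centered_frac x \is a Num.int.
Proof. by rewrite /centered_frac subKr intr_int. Qed.

Lemma centered_frac_le (R : realType) (x : R) : `|centered_frac x| <= 2^-1.
Proof.
have := floor_itv (x + 2^-1).
rewrite /centered_frac intrD; set n := _%:~R => /andP[n1 n2].
by rewrite ler_norml; apply/andP; split; lra.
Qed.

(** Two representatives of absolute value at most 1/2, one of them strictly below 1/2, differ by an
    integer of absolute value less than 1. *)
Lemma centered_frac_unique (R : realType) (x y : R) :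
  x - y \is a Num.int -> `|y| < 2^-1 -> centered_frac x = y.
Proof.
move=> xy y2; apply/eqP; rewrite -subr_eq0; apply/eqP/int_lt1_eq0.
  rewrite -(rpredN _ (centered_frac x - y)) opprB.
  rewrite (_ : y - _ = (x - centered_frac x) - (x - y)); last by lra.
  by rewrite rpredB// centered_frac_mod.
all: by move: y2 (centered_frac_le x); rewrite ltr_norml ler_norml; lra.
Qed.

Lemma centered_frac_eq (R : realType) (x y : R) :
  x - y \is a Num.int -> centered_frac x = centered_frac y.
Proof.
move=> /intrP[n xy]; rewrite /centered_frac.
have -> : x = y + n%:~R by lra.
by rewrite (addrAC y n%:~R 2^-1) floorDrz ?intr_int// intrKfloor intrD; lra.
Qed.

Definition near_int (R : realType) (e x : R) :=
  exists n : int, `|x - n%:~R| < e.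

Lemma near_int_centered_frac (R : realType) (e x : R) :
  e <= 2^-1 -> near_int e x -> `|centered_frac x| < e.
Proof.
move=> e2 [n xn]; rewrite (@centered_frac_unique _ x (x - n%:~R))//.
  by rewrite subKr intr_int.
exact: lt_le_trans e2.
Qed.

Lemma near_intB (R : realType) (d e x y : R) :
  near_int d x -> near_int e y -> near_int (d + e) (x - y).
Proof.
move=> [m xm] [n yn]; exists (m - n).
rewrite intrB (_ : _ - _ = (x - m%:~R) - (y - n%:~R)); last by lra.
by rewrite (le_lt_trans (ler_normB _ _))// ltrD.
Qed.

Definition winding (R : realType) (Y : nat -> R) (n : nat) : R :=
  \sum_(0 <= i < n) centered_frac (Y i.+1 - Y i).

(** Around each cell of the two rows the four reduced increments have absolute value below 1/4.
    Their signed sum is an integer of absolute value less than 1, hence 0, so horizontal differences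
    may be traded for vertical ones. *)
Lemma winding_eq (R : realType) (Y Z : nat -> R) (n : nat) :
  (forall i, (i < n)%N -> near_int 4^-1 (Y i.+1 - Y i)) ->
  (forall i, (i < n)%N -> near_int 4^-1 (Z i.+1 - Z i)) ->
  (forall i, (i <= n)%N -> near_int 4^-1 (Y i - Z i)) ->
  Y n - Y 0%N \is a Num.int -> Z n - Z 0%N \is a Num.int ->
  winding Y n = winding Z n.
Proof.
move=> Y4 Z4 YZ4 Yn Zn; apply/eqP; rewrite -subr_eq0 -sumrB.
have -> : \sum_(0 <= i < n) (centered_frac (Y i.+1 - Y i) -
    centered_frac (Z i.+1 - Z i)) =
  \sum_(0 <= i < n) (centered_frac (Y i.+1 - Z i.+1) -
    centered_frac (Y i - Z i)).
  apply: eq_big_nat => i /andP[_ ilt].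
  set a := Y i.+1 - Y i; set b := Z i.+1 - Z i.
  set c := Y i.+1 - Z i.+1; set d := Y i - Z i.
  have le42 : 4^-1 <= 2^-1 :> R by lra.
  have := near_int_centered_frac le42 (Y4 _ ilt).
  have := near_int_centered_frac le42 (Z4 _ ilt).
  have := near_int_centered_frac le42 (YZ4 _ ilt).
  have := near_int_centered_frac le42 (YZ4 _ (ltnW ilt)).
  rewrite -/a -/b -/c -/d !ltr_norml => ? ? ? ?.
  apply/eqP; rewrite -subr_eq0; apply/eqP/int_lt1_eq0; [|lra|lra].
    rewrite (_ : _ - _ = (c - centered_frac c) - (d - centered_frac d)
      - (a - centered_frac a) + (b - centered_frac b)); last first.
      by rewrite /a /b /c /d; ring.
    by apply: rpredD; [apply: rpredB; [apply: rpredB|]|];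
      exact: centered_frac_mod.
(* Only the vertical increments at the two ends survive; they agree modulo integers because both
   rows close up. *)
rewrite telescope_sumr// subr_eq0; apply/eqP/centered_frac_eq.
rewrite (_ : _ - _ = (Y n - Y 0%N) - (Z n - Z 0%N)); last by ring.
exact: rpredB.
Qed.

(** * Noncontractibility of a loop running once around the torus *)

Section Noncontractible.
Context {R : realType}.
(** An abstract coordinate that descends to a map from the torus to R/Z. It is later taken to be
    [fst] or [snd], so that horizontal and vertical loops share one argument. *)
Variable k : R * R -> R.
Hypothesis k_cont : continuous k.
Hypothesis k_lattice : forall p q, lattice_rel p q -> k p - k q \is a Num.int.

(* [repr] makes this coordinate discontinuous, except modulo integers. *)
Let kt (p : torus R) : R := k (repr p).

Let kt_proj (x y : R) : kt (torus_proj x y) - k (x, y) \is a Num.int.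
Proof.
apply: k_lattice.
by apply/eqquotP; exact: reprK.
Qed.

(** This is continuity of [kt] as a map to R/Z. Openness is tested on the preimage in the plane,
    where [kt] may be replaced by [k] at the cost of an integer; the preimage is then a union of
    open sets indexed by that integer. *)
Let nbhs_kt (p : torus R) (e : R) : 0 < e ->
  nbhs p [set q | near_int e (kt q - kt p)].
Proof.
move=> e0; apply: open_nbhs_nbhs; split; last first.
  by exists 0; rewrite /= subrr subr0 normr0.
rewrite /open/= /quotient_open.
rewrite (_ : _ @^-1` _ =
    \bigcup_(n : int) [set z | `|k z - kt p - n%:~R| < e]).
  apply: bigcup_open => n _.
  apply: (@open_comp _ _ (fun z => `|k z - kt p - n%:~R|) [set x | x < e]).
    move=> z _; apply: cvg_norm; apply: cvgB; last exact: cvg_cst.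
    by apply: cvgB; [exact: k_cont|exact: cvg_cst].
  exact: open_lt.
apply/seteqP; split => [[x y]/= [n xyn]|[x y]/= [n _ /= xyn]].
  have /intrP[m km] := kt_proj x y.
  exists (n - m) => //=; rewrite intrB -km.
  by rewrite [X in `|X|](_ : _ = kt (torus_proj x y) - kt p - n%:~R)//; lra.
have /intrP[m km] := kt_proj x y.
exists (n + m); rewrite intrD -km.
rewrite -/(torus_proj x y).
by rewrite [X in `|X|](_ : _ = k (x, y) - kt p - n%:~R)//; lra.
Qed.

(** Uniform continuity of [kt \o H] modulo integers, by compactness. *)
Let near_kt (S : set (R * R)) (H : R * R -> torus R) :
  compact S -> {within S, continuous H} ->
  \forall e \near 0^'+, forall p q, S p -> S q -> ball p e q ->
    near_int 4^-1 (kt (H q) - kt (H p)).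
Proof.
move=> /compact_near_coveringP cS /subspace_continuousP Hc.
(* The covering property ranges over all points near a point of [S], including those outside [S], so
   membership is repeated inside the predicate. *)
have := cS R 0^'+ (fun e p => S p -> forall q, S q -> ball p e q ->
    near_int 4^-1 (kt (H q) - kt (H p))) _.
have KS : forall p, S p -> \forall p' \near p & e \near 0^'+, S p' ->
    forall q, S q -> ball p' e q -> near_int 4^-1 (kt (H q) - kt (H p')).
  move=> p Sp.
  (* Both [p'] and [q] are compared with the centre [p], so each comparison gets half of 1/4.
     Likewise the radius is halved below to keep [q] in the ball around [p]. *)
  have e8 : 0 < 8^-1 :> R by [].
  have := Hc _ Sp _ (nbhs_kt (H p) e8); rewrite /= => /nbhs_ballP[r /= r0 rH].
  exists (ball p (r / 2), [set e | e < r / 2]) => /=.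
    split; first by apply: nbhsx_ballx; rewrite divr_gt0.
    by apply: nbhs_right_lt; rewrite divr_gt0.
  move=> [p' e]/= [pp' er] Sp' q Sq p'q.
  have pq : ball p r q.
    rewrite (splitr r); apply: ball_triangle pp' _.
    exact: le_ball (ltW er) _ p'q.
  have {}pp' : ball p r p' by apply: le_ball pp'; lra.
  have h1 := rH _ pq Sq; have h2 := rH _ pp' Sp'.
  have := near_intB h1 h2.
  rewrite (_ : 8^-1 + 8^-1 = 4^-1)//; last by lra.
  by rewrite (_ : _ - _ - (_ - _) = kt (H q) - kt (H p'))//; lra.
move=> /(_ _ KS); apply: filterS => e eP p q Sp Sq pq; exact: (eP _ Sp Sp).
Qed.

Lemma not_contractible (c : R -> torus R) :
  (forall t : R, 0 <= t <= 1 ->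
    exists x y, c t = torus_proj x y /\ k (x, y) = t) ->
  ~ contractible c.
Proof.
move=> cE [H [Hc H0 Hloop [p H1]]].
pose S : set (R * R) := `[0, 1] `*` `[0, 1].
have cS : compact S.
  by apply: compact_setX; exact: segment_compact.
have [e e0 He] : exists2 e : R, 0 < e & forall p q, S p -> S q -> ball p e q ->
    near_int 4^-1 (kt (H q) - kt (H p)).
  have H' := near_kt cS Hc.
  have [e [e0 ?]] := filter_ex (filterI (nbhs_right_gt 0) H').
  by exists e.
(* The second bound makes [He] apply to adjacent grid points; the first keeps the increment [1/N]
   along [c] below 1/2, so that reduction leaves it unchanged. *)
have [N [N4 Ne]] : exists N : nat, 4 < N%:R :> R /\ N%:R^-1 < e.
  pose N := (Num.truncn (Num.max 4 e^-1)).+1.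
  have NP : Num.max 4 e^-1 < N%:R :> R by exact: truncnS_gt.
  move: NP; rewrite gt_max => /andP[N4 Ne]; exists N; split => //.
  by rewrite invf_plt// posrE ltr0n.
have N0 : 0 < N%:R :> R by exact: lt_trans N4.
have in01 i : (i <= N)%N -> 0 <= (i%:R / N%:R : R) <= 1.
  by move=> iN; rewrite divr_ge0//= ler_pdivrMr// mul1r ler_nat.
have dist i : i.+1%:R / N%:R - i%:R / N%:R = N%:R^-1 :> R.
  by rewrite -mulrBl -natrB// subSnn mul1r.
have ball0 (x : R) : ball x e x by exact: ballxx.
have balls i : ball (i%:R / N%:R : R) e (i.+1%:R / N%:R : R).
  by rewrite /ball/= distrC dist gtr0_norm// invr_gt0.
(* Row [j] samples the loop at homotopy time [j/N]: row 0 is [c] and row [N] is constant. *)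
pose Y (j i : nat) : R := kt (H (j%:R / N%:R, i%:R / N%:R)).
have Yint j : (j <= N)%N -> Y j N - Y j 0%N \is a Num.int.
  move=> jN; rewrite /Y divff ?gt_eqF// mul0r -Hloop ?subrr ?rpred0//.
  exact: in01.
have inS i j : (i <= N)%N -> (j <= N)%N ->
    S (i%:R / N%:R, j%:R / N%:R).
  by move=> iN jN; split; rewrite /= in_itv/= in01.
have step j : (j < N)%N -> winding (Y j.+1) N = winding (Y j) N.
  move=> jN; apply: winding_eq; rewrite ?Yint// 1?ltnW// => i iN;
    by apply: He; [apply: inS => //; exact: ltnW..|split => /=].
have const j : (j <= N)%N -> winding (Y j) N = winding (Y 0%N) N.
  by elim: j => // j IH jN; rewrite step// IH// ltnW.
have := const _ (leqnn N).
have -> : winding (Y N) N = 0.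
  rewrite /winding big_nat big1// => i /andP[_ iN].
  rewrite /Y divff ?gt_eqF// !H1 ?in01// 1?ltnW// subrr.
  by apply: centered_frac_unique; rewrite ?subrr ?rpred0// normr0 invr_gt0.
have -> : winding (Y 0%N) N = 1.
  rewrite /winding (eq_big_nat _ _ (F2 := fun=> N%:R^-1)).
    by rewrite sumr_const_nat subn0 -[_ *+ _]mulr_natr mulVf// gt_eqF.
  move=> i /andP[_ iN]; apply: centered_frac_unique.
    rewrite /Y mul0r !H0 ?in01// 1?ltnW//.
    have [x [y [-> kxy]]] := cE _ (in01 _ iN).
    have [x' [y' [-> kxy']]] := cE _ (in01 _ (ltnW iN)).
    (* The increments of [kt] and of [k] agree modulo integers, and the latter is exactly [1/N]. *)
    rewrite -(dist i) -{1}kxy -{1}kxy'.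
    rewrite (_ : _ - _ = (kt (torus_proj x y) - k (x, y)) -
      (kt (torus_proj x' y') - k (x', y'))); last by lra.
    by rewrite rpredB.
  by rewrite gtr0_norm ?invr_gt0// ltf_pV2 ?posrE//; lra.
by move=> /eqP; rewrite eq_sym oner_eq0.
Qed.

End Noncontractible.

(** * Mean, variance and absolute deviation under a probability measure *)

Section Moments.
Context {d : measure_display} {T : measurableType d} {R : realType}.
Variables (mu : {measure set T -> \bar R}) (D : set T).
Hypotheses (mD : measurable D) (muD : mu D = 1%E).

Lemma bounded_Rintegrable (g : T -> R) (M : R) :
  measurable_fun D g -> (forall x, D x -> `|g x| <= M) ->
  mu.-integrable D (EFin \o g).
Proof.
move=> mg gM; apply: measurable_bounded_integrable => //.
  by rewrite muD ltry.
rewrite /bounded_near; near=> N => x Dx /=; apply: le_trans (gM _ Dx) _.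
by near: N; apply: nbhs_pinfty_ge; exact: num_real.
Unshelve. all: by end_near.
Qed.

Variables (g : T -> R) (a M : R).
Hypotheses (mg : measurable_fun D g) (ag : forall x, D x -> a <= g x)
  (gM : forall x, D x -> `|g x| <= M).

Let m := \int[mu]_(x in D) g x.

Let ig : mu.-integrable D (EFin \o g).
Proof. exact: bounded_Rintegrable gM. Qed.

Let icst (c : R) : mu.-integrable D (EFin \o cst c).
Proof.
by apply: (@bounded_Rintegrable _ `|c|) => //; exact: measurable_cst.
Qed.

Let int_cst (c : R) : \int[mu]_(x in D) c = c.
Proof. by rewrite Rintegral_cst// muD mulr1. Qed.

(** The square expands as [g ^ 2 - (2 m g - m ^ 2)], and the bracket has integral [m ^ 2] since [D]
    has measure 1. *)
Lemma second_moment_sub_variance :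
  \int[mu]_(x in D) (g x ^+ 2) - \int[mu]_(x in D) ((g x - m) ^+ 2) = m ^+ 2.
Proof.
have ig2 : mu.-integrable D (EFin \o (fun x => g x ^+ 2)).
  apply: (@bounded_Rintegrable _ (M ^+ 2)); first exact: measurable_funX.
  move=> x Dx; have gx := gM Dx.
  by rewrite normrX lerXn2r ?nnegrE// (le_trans _ gx).
have igm : mu.-integrable D (EFin \o (fun x => 2 * m * g x)).
  exact: (integrableZl mD (2 * m) ig).
have igmm : mu.-integrable D (EFin \o (fun x => 2 * m * g x - m ^+ 2)).
  exact: (integrableB mD igm (icst (m ^+ 2))).
have -> : \int[mu]_(x in D) ((g x - m) ^+ 2) =
    \int[mu]_(x in D) (g x ^+ 2 - (2 * m * g x - m ^+ 2)).
  by apply: eq_Rintegral => x _; ring.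
rewrite (RintegralB mD ig2 igmm) (RintegralB mD igm (icst _)).
rewrite RintegralZl// (int_cst (m ^+ 2)) -/m; ring.
Qed.

Lemma le_mean : a <= m.
Proof. by rewrite -(int_cst a); exact: (le_Rintegral mD (icst a) ig). Qed.

(** In the pointwise bound by [g - m + 2 (m - a)], one sign needs [a <= m] and the other [a <= g];
    the term [g - m] integrates to 0. *)
Lemma absolute_deviation_le :
  \int[mu]_(x in D) `|g x - m| <= 2 * (m - a).
Proof.
have igm : mu.-integrable D (EFin \o (fun x => g x - m)).
  exact: (integrableB mD ig (icst m)).
have -> : 2 * (m - a) = \int[mu]_(x in D) (g x - m + 2 * (m - a)).
  rewrite (RintegralD mD igm (icst _)) (RintegralB mD ig (icst _)).
  rewrite (int_cst m) (int_cst (2 * (m - a))).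
  by rewrite -/m; ring.
apply: le_Rintegral => //.
- exact: (integrable_norm igm).
- exact: (integrableD mD igm (icst (2 * (m - a)))).
- move=> x Dx; rewrite ler_norml; have := ag Dx; have := le_mean; lra.
Qed.

End Moments.

(** * Lengths of coordinate loops and bounds on the systole *)

Lemma lebesgue_measure_unit_itv (R : realType) :
  lebesgue_measure (`[0, 1]%classic : set R) = 1%E.
Proof. by rewrite lebesgue_measure_itv/= lte01 oppr0 adde0. Qed.

Lemma continuous_pairl (R : realType) (x : R) :
  continuous (fun t : R => (x, t)).
Proof.
move=> t.
apply: (@cvg_pair _ _ _ (nbhs t) (nbhs x) (nbhs t) _ _ _ (fun=> x) id).
  exact: cvg_cst.
exact: cvg_id.
Qed.

Lemma continuous_pairr (R : realType) (y : R) :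
  continuous (fun t : R => (t, y)).
Proof.
move=> t.
apply: (@cvg_pair _ _ _ (nbhs t) (nbhs t) (nbhs y) _ _ _ id (fun=> y)).
  exact: cvg_id.
exact: cvg_cst.
Qed.

Section Length.
Context {R : realType}.
Implicit Types (g : metric_tensor R) (c : R -> torus R) (f : torus R -> R).

Lemma has_length_ge0 g c (a b l : R) : has_length g c a b l -> 0 <= l.
Proof.
by elim=> *; [apply: Rintegral_ge0 => *; exact: sqrtr_ge0|exact: addr_ge0].
Qed.

Lemma systole_ge0 g : 0 <= systole g.
Proof.
rewrite /systole; set E := (X in inf X).
(* The infimum of the empty set is 0 by convention, so no noncontractible loop has to be exhibited
   here. *)
have [->|/set0P E0] := eqVneq E set0; first by rewrite inf0.
by apply: lb_le_inf => // l [c [_ _ /has_length_ge0]].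
Qed.

Lemma systole_le_length g c (l : R) :
  loop c -> ~ contractible c -> has_length g c 0 1 l -> systole g <= l.
Proof.
move=> cl cn cl0; apply: ge_inf; last by exists c.
by exists 0 => ? [? [_ _ /has_length_ge0]].
Qed.

Lemma torus_proj_continuous : continuous (fun p : R * R => torus_proj p.1 p.2).
Proof.
rewrite (_ : (fun _ => _) = \pi_(quotient_topology {eq_quot lattice_equiv})%qT).
  exact: pi_continuous.
by apply/funext => -[].
Qed.

Lemma tangent_norm_conformal_flat f p (u v : R) : 0 <= f p ->
  tangent_norm (conformal f flat) p u v = f p * Num.sqrt (u ^+ 2 + v ^+ 2).
Proof.
move=> f0; rewrite /tangent_norm /= -[in RHS](ger0_norm f0) -sqrtr_sqr.
by rewrite -sqrtrM ?sqr_ge0//; congr Num.sqrt; ring.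
Qed.

Lemma C1_cst (x : R) : C1 (cst x).
Proof.
split=> [t|]; first exact: derivable_cst.
rewrite (_ : derive1 _ = (cst 0 : R -> R)); first exact: cst_continuous.
by apply/funext => t; rewrite derive1_cst.
Qed.

Lemma C1_id : C1 (@id R).
Proof.
split=> [t|]; first exact: derivable_id.
rewrite (_ : derive1 _ = (cst 1 : R -> R)); first exact: cst_continuous.
by apply/funext => t; rewrite derive1_id.
Qed.

Lemma has_length_unit_speed f (x y : R -> R) (l : R) : 0 <= l ->
  C1 x -> C1 y ->
  (forall t, derive1 x t ^+ 2 + derive1 y t ^+ 2 = 1) ->
  (forall t, f (torus_proj (x t) (y t)) = l) ->
  has_length (conformal f flat) (fun t => torus_proj (x t) (y t)) 0 1 l.
Proof.
move=> l0 x1 y1 xy1 fl.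
have := length_piece (conformal f flat) ltr01 x1 y1 (fun _ _ => erefl).
(* The constructor gives the length as an integral. Its integrand is constantly [l], and the
   parameter interval has measure 1. *)
congr (has_length _ _ _ _ _).
under eq_Rintegral do
  rewrite tangent_norm_conformal_flat ?fl// xy1 sqrtr1 mulr1.
rewrite Rintegral_cst// -[RHS]mulr1; congr (_ * _).
exact: (congr1 fine (lebesgue_measure_unit_itv R)).
Qed.

Lemma torus_projD1 (x y : R) :
  torus_proj (x + 1) y = torus_proj x y /\
  torus_proj x (y + 1) = torus_proj x y.
Proof.
by split; apply/eqquotP; rewrite /= /lattice_rel/= subrr addrAC subrr add0r
  rpred0 rpred1.
Qed.

Lemma systole_le_vertical f (x : R) : (forall p, 0 < f p) ->
  only_depends_on_x f -> systole (conformal f flat) <= f (torus_proj x 0).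
Proof.
move=> f0 fx; apply: (@systole_le_length _ (fun t => torus_proj x t)).
- split; last by have [_ <-] := torus_projD1 x 0; rewrite add0r.
  apply: continuous_subspaceT => t.
  apply: (@continuous_comp _ _ _ (fun t => (x, t))
    (fun p : R * R => torus_proj p.1 p.2)); last exact: torus_proj_continuous.
  exact: continuous_pairl.
- apply: (@not_contractible _ snd) => [p|p q /andP[]//|t _].
    exact: cvg_snd.
  by exists x, t.
- apply: (@has_length_unit_speed _ (cst x) id).
  + exact: ltW.
  + exact: C1_cst.
  + exact: C1_id.
  + by move=> t; rewrite derive1_cst derive1_id expr0n expr1n add0r.
  + by move=> t; exact: fx.
Qed.

Lemma systole_le_horizontal f (y : R) : (forall p, 0 < f p) ->
  only_depends_on_y f -> systole (conformal f flat) <= f (torus_proj 0 y).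
Proof.
move=> f0 fy; apply: (@systole_le_length _ (fun t => torus_proj t y)).
- split; last by have [<- _] := torus_projD1 0 y; rewrite add0r.
  apply: continuous_subspaceT => t.
  apply: (@continuous_comp _ _ _ (fun t => (t, y))
    (fun p : R * R => torus_proj p.1 p.2)); last exact: torus_proj_continuous.
  exact: continuous_pairr.
- apply: (@not_contractible _ fst) => [p|p q /andP[]//|t _].
    exact: cvg_fst.
  by exists t, y.
- apply: (@has_length_unit_speed _ id (cst y)).
  + exact: ltW.
  + exact: C1_id.
  + exact: C1_cst.
  + by move=> t; rewrite derive1_cst derive1_id expr0n expr1n addr0.
  + by move=> t; exact: fy.
Qed.

(* [lebesgue_measure] lives on [measurableTypeR R], whose display differs from
   that of the canonical measurable structure of [R]. *)
Lemma area_sub_variance_ge f (phi : R -> R) (pr : R * R -> R) :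
  (forall p, 0 < f p) -> continuous phi ->
  measurable_fun [set: measurableTypeR R * measurableTypeR R] pr ->
  (forall p, (`[0, 1] `*` `[0, 1]) p -> pr p \in `[0, 1]) ->
  (forall p, f (torus_proj p.1 p.2) = phi (pr p)) ->
  (forall t, systole (conformal f flat) <= phi t) ->
  (systole (conformal f flat) + 2^-1 * L1norm (centered f)) ^+ 2 <=
  area (conformal f flat) - torus_variance f.
Proof.
move=> f0 phic mpr pr01 fphi sys_phi.
pose D : set (measurableTypeR R * measurableTypeR R) := `[0, 1] `*` `[0, 1].
pose mu : {measure set (measurableTypeR R * measurableTypeR R) -> \bar R} :=
  (@lebesgue_measure R \x @lebesgue_measure R)%E.
have mD : measurable D by exact: measurableX.
have muD : mu D = 1%E.
  apply: etrans (product_measure1E _ _ _ _) _ => //; rewrite -[RHS]mule1.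
  by congr (_ * _)%E; exact: lebesgue_measure_unit_itv.
have phic01 : {within `[0, 1], continuous phi} by exact: continuous_subspaceT.
(* Extrema over the unit interval suffice, since [pr] maps the fundamental square into it. The
   minimum [phi b] serves as the lower bound [a] of the moment estimates. *)
have [b _ minphi] := EVT_min ler01 phic01.
have [M _ maxphi] := EVT_max ler01 phic01.
pose g (p : measurableTypeR R * measurableTypeR R) := phi (pr p).
have mg : measurable_fun D g.
  apply: measurableT_comp; first exact: continuous_measurable_fun.
  exact: measurable_funTS.
have bg p : D p -> phi b <= g p by move=> /pr01; exact: minphi.
have gM p : D p -> `|g p| <= phi M.
  by move=> /pr01 Dp; rewrite /g ger0_norm ?maxphi// -fphi ltW.
pose m := \int[mu]_(p in D) g p.
have meanE : torus_mean f = m by apply: eq_Rintegral => p _; exact: fphi.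
have areaE : area (conformal f flat) = \int[mu]_(p in D) (g p ^+ 2).
  apply: eq_Rintegral => p _ /=; rewrite fphi -/(g p).
  rewrite !mulr1 mulr0 expr0n subr0 -expr2 sqrtr_sqr ger0_norm//.
  exact: sqr_ge0.
have varE : torus_variance f = \int[mu]_(p in D) ((g p - m) ^+ 2).
  by apply: eq_Rintegral => p _; rewrite meanE fphi.
have L1E : L1norm (centered f) = \int[mu]_(p in D) `|g p - m|.
  by apply: eq_Rintegral => p _; rewrite /centered meanE fphi.
rewrite areaE varE (second_moment_sub_variance mD muD mg gM) -/m.
have := absolute_deviation_le mD muD mg bg gM.
rewrite -L1E -/m => dev.
(* Together with [dev] this gives [0 <= sys + |f_0|_1 / 2 <= m]; nonnegativity is what permits
   squaring. *)
have := sys_phi b; have := systole_ge0 (conformal f flat).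
have L0 : 0 <= L1norm (centered f) by exact: Rintegral_ge0.
by move=> ? ?; apply: lerXn2r; rewrite ?nnegrE; clear muD; lra.
Qed.

End Length.

Theorem theorem6p2 (R : realType) (f : torus R -> R)
    (f_cont : continuous f) (f_gt0 : forall p : torus R, 0 < f p)
    (f_one_var : only_depends_on_x f \/ only_depends_on_y f) :
  area (conformal f flat) - torus_variance f >=
    (systole (conformal f flat) + 2^-1 * L1norm (centered f)) ^+ 2.
Proof.
have fpi : continuous (fun p : R * R => f (torus_proj p.1 p.2)).
  move=> p; apply: continuous_comp; last exact: f_cont.
  exact: torus_proj_continuous.
case: f_one_var => [fx|fy].
(* Here [f] factors through [fst] as its restriction to the axis [y = 0], whose values are the
   lengths of the vertical loops. *)
- apply: (@area_sub_variance_ge _ _ (fun x => f (torus_proj x 0)) fst) => //.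
  + move=> x; apply: (@continuous_comp _ _ _ (fun x => (x, 0)) _ _ _ (fpi _)).
    exact: continuous_pairr.
  + by move=> p [].
  + by move=> x; exact: systole_le_vertical.
- apply: (@area_sub_variance_ge _ _ (fun y => f (torus_proj 0 y)) snd) => //.
  + move=> y; apply: (@continuous_comp _ _ _ (fun y => (0, y)) _ _ _ (fpi _)).
    exact: continuous_pairl.
  + by move=> p [].
  + by move=> y; exact: systole_le_horizontal.
Qed.
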